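(* Suppose all groups are interior, i.e. $1\le y_j\le n_j-1$ for every $j=1,\dots,k$. Let $u>0$ and let $(r,\boldsymbol\beta)$ have the joint hyper-prior density $\pi_{\mathrm{hyp.prior}}(r,\boldsymbol\beta)\propto 1/r^{u+1}$ on $(0,\infty)\times\mathbf R^m$. Then the joint posterior density function of the hyper-parameters, $\pi_{\mathrm{hyp.post}}(r,\boldsymbol\beta\mid\boldsymbol y)\propto \pi_{\mathrm{hyp.prior}}(r,\boldsymbol\beta)\,L(r,\boldsymbol\beta)$, is proper if and only if (i) $k\ge u+1$ and (ii) $\operatorname{rank}(\boldsymbol X)=m$.
   Context: Beta-Binomial-Logit model. There are $k\ge 1$ groups; group $j$ has an integer number of trials $n_j\ge 1$, an observed number of successes $y_j\in\{0,1,\dots,n_j\}$, and a fixed covariate vector $\boldsymbol x_j\in\mathbf R^m$, with $k\ge m\ge 1$. Put $\boldsymbol y=(y_1,\dots,y_k)^\top$ and let $\boldsymbol X=(\boldsymbol x_1,\dots,\boldsymbol x_k)^\top$ be the $k\times m$ covariate matrix. The hyper-parameters are $r\in(0,\infty)$ and $\boldsymbol\beta\in\mathbf R^m$. Write $$p^E_j=p^E_j(\boldsymbol\beta)=\frac{\exp(\boldsymbol x_j^\top\boldsymbol\beta)}{1+\exp(\boldsymbol x_j^\top\boldsymbol\beta)},\qquad q^E_j=1-p^E_j .$$ The likelihood function (a product of Beta-Binomial probability mass functions) is $$L(r,\boldsymbol\beta)=\prod_{j=1}^k\binom{n_j}{y_j}\frac{B(y_j+rp^E_j,\;n_j-y_j+rq^E_j)}{B(rp^E_j,\;rq^E_j)},$$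 where $B(a,b)=\int_0^1 v^{a-1}(1-v)^{b-1}\,dv$ for $a,b>0$ is the beta function. Given a (possibly improper) joint hyper-prior density $\pi_{\mathrm{hyp.prior}}(r,\boldsymbol\beta)$, the posterior $\pi_{\mathrm{hyp.post}}(r,\boldsymbol\beta\mid\boldsymbol y)\propto \pi_{\mathrm{hyp.prior}}(r,\boldsymbol\beta)L(r,\boldsymbol\beta)$ is called proper if $\int_{\mathbf R^m}\int_0^\infty \pi_{\mathrm{hyp.prior}}(r,\boldsymbol\beta)L(r,\boldsymbol\beta)\,dr\,d\boldsymbol\beta<\infty$ and improper if this integral is infinite.
   Formalization: Condition (i) k ≥ u+1 is kept only for integer u; for every real u > 0 it is replaced by k > u, since the printed ''only if'' fails for non-integer u (e.g. k = m = 1, X = (1), n = 2, y = 1, u = 1/2 gives a proper posterior). *)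

(* Defs.v *)
From HB Require Import structures.
From mathcomp Require Import all_boot all_order all_algebra.
From mathcomp Require Import all_classical all_reals all_analysis.

Set Implicit Arguments.
Unset Strict Implicit.
Unset Printing Implicit Defensive.

Import Order.TTheory GRing.Theory Num.Theory.
Import numFieldNormedType.Exports.

Local Open Scope classical_set_scope.
Local Open Scope ring_scope.

(* The image of the product measure of mu and nu under (x, t) |-> x :: t. *)
Section cons_measure.
Context d (T : measurableType d) (R : realType) (n : nat).
Variables (mu : {sigma_finite_measure set T -> \bar R})
  (nu : {sigma_finite_measure set (n.-tuple T) -> \bar R}).

Definition consp (z : T * n.-tuple T) : n.+1.-tuple T := [tuple of z.1 :: z.2].

Lemma measurable_consp : measurable_fun [set: T * n.-tuple T] consp.
Proof. by apply: measurable_cons. Qed.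

Definition cons_measure : set (n.+1.-tuple T) -> \bar R :=
  pushforward (mu \x nu)%E consp.

Let cons_measure0 : cons_measure set0 = 0%E.
Proof. by rewrite /cons_measure /pushforward preimage_set0 measure0. Qed.

Let cons_measure_ge0 A : (0 <= cons_measure A)%E.
Proof. by rewrite /cons_measure /pushforward; apply: measure_ge0. Qed.

Let cons_measure_sigma_additive : semi_sigma_additive cons_measure.
Proof.
move=> F mF tF mUF; rewrite /cons_measure /pushforward preimage_bigcup.
have mc A : measurable A -> measurable (consp @^-1` A).
  by move=> mA; rewrite -[X in measurable X]setTI; exact: measurable_consp.
apply: measure_semi_sigma_additive.
- by move=> i; exact: mc.
- apply/trivIsetP => /= i j _ _ ij; rewrite -preimage_setI.
  by move/trivIsetP : tF => /(_ _ _ _ _ ij) ->//; rewrite preimage_set0.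
- by rewrite -preimage_bigcup; exact: mc.
Qed.

HB.instance Definition _ := isMeasure.Build _ _ _ cons_measure
  cons_measure0 cons_measure_ge0 cons_measure_sigma_additive.

Let cons_measure_sigma_finite : sigma_finite setT cons_measure.
Proof.
have /sigma_finiteP[F [FT ndF Foo]] := sigma_finiteT mu.
have /sigma_finiteP[G [GT ndG Goo]] := sigma_finiteT nu.
pose g (t : n.+1.-tuple T) := (thead t, [tuple of behead t]).
have mg : measurable_fun setT g.
  apply/measurable_fun_pairP; split.
    exact: (measurable_tnth (T := T) (ord0 : 'I_n.+1)).
  exact: measurable_behead.
have gK : cancel consp g.
  by move=> [x t]; rewrite /g /consp; congr pair; apply/val_inj.
exists (fun i => g @^-1` (F i `*` G i)).
  rewrite -preimage_bigcup (_ : \bigcup_i _ = setT) ?preimage_setT//.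
  apply/seteqP; split=> // -[x t] _.
  have : [set: T] x by [].
  rewrite FT => -[i _ Fix].
  have : [set: n.-tuple T] t by [].
  rewrite GT => -[j _ Gjt]; exists (maxn i j) => //; split.
    by move: x Fix; exact/subsetPset/ndF/leq_maxl.
  by move: t Gjt; exact/subsetPset/ndG/leq_maxr.
move=> i; have [mF Fioo] := Foo i; have [mG Gioo] := Goo i; split.
  by rewrite -[X in measurable X]setTI; apply: mg => //; exact: measurableX.
rewrite /cons_measure /pushforward -comp_preimage (_ : g \o consp = id).
  rewrite preimage_id product_measure1E// lte_mul_pinfty//.
  by rewrite ge0_fin_numE.
by apply/funext => z; exact: gK.
Qed.

HB.instance Definition _ := Measure_isSigmaFinite.Build _ _ _ cons_measure
  cons_measure_sigma_finite.

End cons_measure.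

(* Lebesgue measure on R^m, the vectors of R^m being the m-tuples of reals. *)
Fixpoint lebesgue_measure_tuple (R : realType) (m : nat) :
    {sigma_finite_measure set (m.-tuple (measurableTypeR R)) -> \bar R} :=
  match m with
  | 0 => \d_([tuple] : 0.-tuple (measurableTypeR R))
  | m'.+1 => cons_measure (@lebesgue_measure R) (lebesgue_measure_tuple R m')
  end.

Section beta_binomial_logit.
Context {R : realType}.

(* Meaningful for positive real [a] and [b]; the library's [beta_fun] only takes
   natural numbers. *)
Definition betaR (a b : R) : R :=
  \int[lebesgue_measure]_(v in `]0, 1[) (v `^ (a - 1) * (1 - v) `^ (b - 1)).

Section model.
Variables (k m : nat) (X : 'M[R]_(k, m)).

(* Row [j] of [X] is the covariate vector of group [j]. *)
Definition linpred (b : m.-tuple R) (j : 'I_k) : R :=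
  \sum_(l < m) X j l * tnth b l.

Definition pE (b : m.-tuple R) (j : 'I_k) : R :=
  expR (linpred b j) / (1 + expR (linpred b j)).

Definition qE (b : m.-tuple R) (j : 'I_k) : R := 1 - pE b j.

Definition likelihood (n y : 'I_k -> nat) (r : R) (b : m.-tuple R) : R :=
  \prod_(j < k) ('C(n j, y j)%:R *
    (betaR ((y j)%:R + r * pE b j) ((n j)%:R - (y j)%:R + r * qE b j) /
     betaR (r * pE b j) (r * qE b j))).

End model.

(* Proportionality on the parameter space (0, oo) x R^m. *)
Definition proportional (m : nat) (f g : R -> m.-tuple R -> R) : Prop :=
  exists2 c : R, 0 < c & forall r b, 0 < r -> f r b = c * g r b.

Definition posterior_proper (k m : nat) (X : 'M[R]_(k, m)) (n y : 'I_k -> nat)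
    (prior : R -> m.-tuple R -> R) : Prop :=
  (\int[lebesgue_measure_tuple R m]_b
     \int[lebesgue_measure]_(r in `]0%R, +oo[)
       (prior r b * likelihood X n y r b)%:E < +oo)%E.

End beta_binomial_logit.

(* Main.v *)
(* The identity [B(a + 1, b + 1) = a b / ((a + b) (a + b + 1)) B(a, b)] and the
   monotonicity of the integrand of [B] show that, for an interior group, the
   likelihood factor is at most [r / (1 + r) * p q], up to a binomial
   coefficient, and at least a constant times [r p q] when [r <= 1], where
   [p = pE] and [q = qE].  Thus the integral over [r] behaves like the one of
   [r ^ (k - u - 1) (1 + r) ^ (- k)]: it is finite exactly when [0 < u < k].
   As [p q] is comparable to [exp (- |x_j . beta|)], the product over [j] is
   dominated by [exp (- c |beta|_1)] when [X] has rank [m], and this is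
   integrable by Tonelli's theorem.  If [X v = 0] for some nonzero [v], the
   product is bounded below on infinitely many disjoint unit cubes whose
   corners lie on the line [R v]. *)

Require Import Defs.
From mathcomp Require Import all_boot all_order all_algebra.
From mathcomp Require Import all_classical all_reals all_analysis.
From mathcomp Require Import measurable_realfun.
From mathcomp Require Import ring lra.

Import Order.TTheory GRing.Theory Num.Theory.
Import numFieldNormedType.Exports.

Set Implicit Arguments.
Unset Strict Implicit.
Unset Printing Implicit Defensive.

Local Open Scope classical_set_scope.
Local Open Scope ring_scope.

Import HBNNSimple.

(** * Comparison of nonnegative integrals *)

(** The integral of a nonnegative function is a supremum over simple functions below it, and a
    simple function below [f] is below [g]. This is applied to inner integrals as functions of the
    outer variable, so their measurability never has to be established. *)
Lemma ge0_le_integral_nonmeasurable d (T : measurableType d) (R : realType)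
    (mu : {measure set T -> \bar R}) (D : set T) (f g : T -> \bar R) :
  (forall x, D x -> 0 <= f x)%E -> (forall x, D x -> f x <= g x)%E ->
  (\int[mu]_(x in D) f x <= \int[mu]_(x in D) g x)%E.
Proof.
move=> f0 fg; rewrite !ge0_integralE//; last first.
  by move=> x Dx; exact: le_trans (f0 x Dx) (fg x Dx).
apply: le_ereal_sup => _ [h hf <-].
exists h => // x; apply: (le_trans (hf x)); rewrite /patch; case: ifPn => //.
by rewrite inE => /fg.
Qed.

Lemma ge0_le_integral_subset d (T : measurableType d) (R : realType)
    (mu : {measure set T -> \bar R}) (A B : set T) (f g : T -> \bar R) :
  A `<=` B ->
  (forall x, A x -> 0 <= f x)%E -> (forall x, A x -> f x <= g x)%E ->
  (forall x, B x -> 0 <= g x)%E ->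
  (\int[mu]_(x in A) f x <= \int[mu]_(x in B) g x)%E.
Proof.
move=> AB f0 fg g0; rewrite (integral_mkcond A) (integral_mkcond B).
apply: ge0_le_integral_nonmeasurable => x _; rewrite /patch.
  by case: ifPn => //; rewrite inE => /f0.
case: ifPn; rewrite ?inE => Ax.
  by rewrite ifT ?fg// inE; exact: AB.
by case: ifPn => //; rewrite inE => /g0.
Qed.

(** * Improper integrals as limits over growing compact intervals *)

Section exhaustion.
Context {R : realType}.
Local Notation mu := (@lebesgue_measure R).

Lemma integral_itv_is_derive (F f : R -> R) (a b : R) : a < b ->
  (forall x, a <= x <= b -> is_derive x 1 F (f x)) ->
  (forall x, a <= x <= b -> derivable f x 1) ->
  (\int[mu]_(x in `[a, b]) (f x)%:E = (F b - F a)%:E)%E.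
Proof.
move=> ab dF df; rewrite EFinB.
have dF' x : a <= x <= b -> derivable F x 1 by case/dF.
have cF x : a <= x <= b -> {for x, continuous F}.
  by move=> /dF' /derivable1_diffP /differentiable_continuous.
apply: continuous_FTC2 => //.
- by apply: derivable_within_continuous => x; rewrite in_itv/=; exact: df.
- split.
  + by move=> x; rewrite in_itv/= => /andP[/ltW ax /ltW xb]; apply: dF'; rewrite ax.
  + by apply: cvg_at_right_filter; apply: cF; rewrite lexx ltW.
  + by apply: cvg_at_left_filter; apply: cF; rewrite lexx ltW.
- move=> x; rewrite in_itv/= => /andP[/ltW ax /ltW xb].
  have dFx : is_derive x 1 F (f x) by apply: dF; rewrite ax.
  by rewrite derive1E derive_val.
Qed.

Lemma cvg_integral_exhaustion (D : set R) (a b : R^nat) (f : R -> R) :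
  (forall n m, (n <= m)%N -> a m <= a n /\ b n <= b m) ->
  D = \bigcup_n `[a n, b n]%classic ->
  measurable_fun D f -> (forall x, D x -> 0 <= f x) ->
  (\int[mu]_(x in `[a n, b n]) (f x)%:E)%E @[n --> \oo] -->
    (\int[mu]_(x in D) (f x)%:E)%E.
Proof.
move=> ab DE mf f0.
have sub n : [set` `[a n, b n]] `<=` D by rewrite DE; apply: (bigcup_sup (F := fun n => [set` `[a n, b n]])).
have mD : measurable D by rewrite DE; apply: bigcup_measurable.
rewrite DE.
apply: ge0_nondecreasing_set_cvg_integral => //.
- move=> n m nm; apply/subsetPset => x /=; rewrite !in_itv/= => /andP[ax xb].
  have [h1 h2] := ab _ _ nm.
  by rewrite (le_trans h1 ax) (le_trans xb h2).
- by move=> i; apply/measurable_EFinP; apply: measurable_funS mf.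
- by move=> i x /sub /f0; rewrite lee_fin.
Qed.

(** On each [[a n, b n]] the integral is [F (b n) - F (a n)], and the limit keeps the bound [M]. No
    limit of [F] at the ends of [D] has to be computed. *)
Lemma ge0_integral_is_derive_le (D : set R) (a b : R^nat) (F f : R -> R) (M : R) :
  (forall n m, (n <= m)%N -> a m <= a n /\ b n <= b m) ->
  (forall n, a n < b n) ->
  D = \bigcup_n `[a n, b n]%classic ->
  (forall x, D x -> 0 <= f x) ->
  (forall x, D x -> is_derive x 1 F (f x)) ->
  (forall x, D x -> derivable f x 1) ->
  (forall n, F (b n) - F (a n) <= M) ->
  (\int[mu]_(x in D) (f x)%:E <= M%:E)%E.
Proof.
move=> ab altb DE f0 dF df FM.
have mf : measurable_fun D f.
  rewrite DE; apply/measurable_fun_bigcup => [n|n]; first by [].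
  apply: subspace_continuous_measurable_fun => //.
  apply: derivable_within_continuous => x xn; apply: df.
  by rewrite DE; exists n.
have sub n x : a n <= x <= b n -> D x.
  by move=> h; rewrite DE; exists n => //=; rewrite in_itv.
have cvg := cvg_integral_exhaustion ab DE mf f0.
rewrite -(cvg_lim _ cvg)//; apply: lime_le; first exact: cvgP cvg.
near=> n.
have -> := integral_itv_is_derive (altb n) (fun x h => dF x (sub n x h))
  (fun x h => df x (sub n x h)).
by rewrite lee_fin.
Unshelve. all: by end_near.
Qed.

(** The offset 3 makes the interval from [lo01 n] to [hi01 n] nondegenerate from the start: it is
    [1/3, 2/3] at [n = 0]. *)
Definition lo01 (n : nat) : R := n.+3%:R^-1.
Definition hi01 (n : nat) : R := 1 - lo01 n.

Lemma lo01_gt0 n : 0 < lo01 n. Proof. by rewrite invr_gt0 ltr0n. Qed.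

Lemma lo01_lthi01 n : lo01 n < hi01 n.
Proof.
have : lo01 n <= 3%:R^-1.
  by rewrite lef_pV2 ?posrE ?ltr0n// ler_nat.
by rewrite /hi01; lra.
Qed.

Lemma lo01_mono n m : (n <= m)%N -> lo01 m <= lo01 n /\ hi01 n <= hi01 m.
Proof.
move=> nm; have h : lo01 m <= lo01 n.
  by rewrite lef_pV2 ?posrE ?ltr0n// ler_nat.
by split=> //; rewrite /hi01 lerB.
Qed.

Lemma cvg_lo01 : lo01 n @[n --> \oo] --> (0 : R).
Proof.
have := @cvg_harmonic R; rewrite -(cvg_shiftn 2).
by apply: cvg_trans; apply: near_eq_cvg; near=> n; rewrite /= /harmonic /lo01 addn2.
Unshelve. all: by end_near.
Qed.

Lemma exhaustion01 : `]0, 1[%classic = \bigcup_n `[lo01 n, hi01 n]%classic :> set R.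
Proof.
apply/seteqP; split=> x /=.
  rewrite in_itv/= => /andP[x0 x1].
  have e0 : 0 < Num.min x (1 - x) by rewrite lt_min x0 subr_gt0.
  have /cvgrPdist_lt/(_ _ e0)[N _ /(_ N (leqnn N))] := cvg_lo01.
  rewrite sub0r normrN gtr0_norm ?lo01_gt0// lt_min => /andP[h1 h2].
  by exists N => //=; rewrite in_itv/= /hi01; apply/andP; split; lra.
move=> [n _] /=; rewrite !in_itv/= /hi01 => /andP[h1 h2].
by have := lo01_gt0 n; lra.
Qed.

End exhaustion.

(** * The beta function *)

Section beta.
Context {R : realType}.
Local Notation mu := (@lebesgue_measure R).

Definition beta_density (a b v : R) : R := v `^ (a - 1) * (1 - v) `^ (b - 1).

Lemma is_derive_powR_1B (c v : R) : v < 1 ->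
  is_derive v 1 (fun v => (1 - v) `^ c) (- (c * (1 - v) `^ (c - 1))).
Proof.
move=> v1.
have h1 : is_derive (1 - v) 1 (@powR R ^~ c) (c * (1 - v) `^ (c - 1)).
  by apply: is_derive1_powR; rewrite subr_gt0.
have h2 : is_derive v 1 (fun v : R => 1 - v) (-1).
  by have := is_deriveB (is_derive_cst (1 : R) v 1) (is_derive_id v 1); rewrite sub0r.
by have := is_derive1_comp (g := fun v : R => 1 - v) h1 h2; rewrite mulrN1.
Qed.

Lemma measurable_powR_1B (D : set R) (c : R) :
  measurable_fun D (fun v : R => (1 - v) `^ c).
Proof.
apply: (@measurable_funS _ _ _ _ setT) => //.
apply: (measurableT_comp (measurable_powR c)).
exact: measurable_funB.
Qed.

Lemma measurable_beta_density (D : set R) (a b : R) :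
  measurable_fun D (beta_density a b).
Proof.
apply: measurable_funM; last exact: measurable_powR_1B.
exact: (@measurable_funS _ _ _ _ setT).
Qed.

Lemma beta_density_ge0 (a b v : R) : 0 <= beta_density a b v.
Proof. by rewrite mulr_ge0 ?powR_ge0. Qed.

Lemma powR_le1 (v c : R) : 0 < v <= 1 -> 0 <= c -> v `^ c <= 1.
Proof. by move=> hv c0; rewrite -(powRr0 v); exact: ger_powR. Qed.

Lemma powRDgt0 (v c e : R) : 0 < v -> v `^ (c + e) = v `^ c * v `^ e.
Proof. by move=> v0; rewrite powRD// (gt_eqF v0) implybT. Qed.

Lemma powRS (v c : R) : 0 < v -> v `^ c = v * v `^ (c - 1).
Proof.
by move=> v0; rewrite -{2}(powRr1 (ltW v0)) -powRDgt0// addrC subrK.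
Qed.

(** Multiply by 1 = v + (1 - v). *)
Lemma beta_density_split (a b v : R) : 0 < v < 1 ->
  beta_density a b v = beta_density (a + 1) b v + beta_density a (b + 1) v.
Proof.
move=> /andP[v0 v1]; rewrite /beta_density !addrK (powRS a v0).
by rewrite (@powRS (1 - v) b) ?subr_gt0//; ring.
Qed.

(** In each term of [beta_density_split] one exponent is positive, so that power is at most 1. The
    bound has an explicit antiderivative, which the density itself lacks. *)
Lemma beta_density_le (a b v : R) : 0 < a -> 0 < b -> 0 < v < 1 ->
  beta_density a b v <= v `^ (a - 1) + (1 - v) `^ (b - 1).
Proof.
move=> a0 b0 hv; have /andP[v0 v1] := hv.
rewrite beta_density_split// /beta_density !addrK addrC.
rewrite lerD//.
  by rewrite ler_piMr ?powR_ge0// powR_le1// ?subr_gt0 ?v1 ?ltW//; lra.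
by rewrite ler_piMl ?powR_ge0// powR_le1// ?v0 ?ltW//; lra.
Qed.

Lemma integral_beta_density_lty (a b : R) : 0 < a -> 0 < b ->
  (\int[mu]_(v in `]0%R, 1%R[) (beta_density a b v)%:E < +oo)%E.
Proof.
move=> a0 b0.
(* [F] is an antiderivative of the majorant [f]; its increments stay below 1/a + 1/b. *)
pose F (v : R) := a^-1 * v `^ a - b^-1 * (1 - v) `^ b.
pose f (v : R) := v `^ (a - 1) + (1 - v) `^ (b - 1).
apply: (@le_lt_trans _ _ (\int[mu]_(v in `]0%R, 1%R[) (f v)%:E)%E).
  apply: ge0_le_integral_nonmeasurable => v /=.
    by rewrite lee_fin beta_density_ge0.
  by rewrite in_itv/= lee_fin; exact: beta_density_le.
apply: (@le_lt_trans _ _ (a^-1 + b^-1)%:E); last by rewrite ltry.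
apply: (@ge0_integral_is_derive_le _ _ lo01 hi01 F).
- exact: lo01_mono.
- exact: lo01_lthi01.
- exact: exhaustion01.
- by move=> x _; rewrite addr_ge0 ?powR_ge0.
- move=> x /=; rewrite in_itv/= => /andP[x0 x1].
  have h1 := is_derive1_powR a x0.
  have h2 := is_derive_powR_1B b x1.
  apply: (is_derive_eq (is_deriveB (is_deriveZ a^-1 h1) (is_deriveZ b^-1 h2))).
  rewrite /f /GRing.scale/=; field.
  by rewrite !gt_eqF.
- move=> x /=; rewrite in_itv/= => /andP[x0 x1].
  have h1 := is_derive1_powR (a - 1) x0.
  have h2 := is_derive_powR_1B (b - 1) x1.
  by apply: derivableD; exact: ex_derive.
- move=> n; rewrite /F.
  have h1 : a^-1 * hi01 n `^ a <= a^-1.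
    rewrite ler_piMr ?invr_ge0 ?(ltW a0)//; apply: powR_le1 (ltW a0).
    by have := @lo01_gt0 R n; have := @lo01_lthi01 R n; rewrite /hi01; lra.
  have h2 : b^-1 * (1 - lo01 n) `^ b <= b^-1.
    rewrite ler_piMr ?invr_ge0 ?(ltW b0)//; apply: powR_le1 (ltW b0).
    by have := @lo01_gt0 R n; have := @lo01_lthi01 R n; rewrite /hi01; lra.
  have h3 : 0 <= a^-1 * lo01 n `^ a by rewrite mulr_ge0 ?invr_ge0 ?powR_ge0 ?ltW.
  have h4 : 0 <= b^-1 * (1 - hi01 n) `^ b by rewrite mulr_ge0 ?invr_ge0 ?powR_ge0 ?ltW.
  lra.
Qed.

(** [betaR] is the finite part of an extended integral, which would be 0 for an infinite one;
    finiteness makes it the true value. *)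
Lemma EFin_betaR (a b : R) : 0 < a -> 0 < b ->
  (betaR a b)%:E = (\int[mu]_(v in `]0%R, 1%R[) (beta_density a b v)%:E)%E.
Proof.
move=> a0 b0; rewrite /betaR /Rintegral fineK// ge0_fin_numE.
  exact: integral_beta_density_lty.
by apply: integral_ge0 => v _; rewrite lee_fin beta_density_ge0.
Qed.

Lemma betaR_le (a b a' b' : R) : 0 < a -> 0 < b -> a <= a' -> b <= b' ->
  betaR a' b' <= betaR a b.
Proof.
move=> a0 b0 aa' bb'.
have a'0 := lt_le_trans a0 aa'; have b'0 := lt_le_trans b0 bb'.
rewrite -lee_fin (EFin_betaR a'0 b'0) (EFin_betaR a0 b0).
apply: ge0_le_integral_nonmeasurable => v /=.
  by rewrite lee_fin beta_density_ge0.
rewrite in_itv/= lee_fin => /andP[v0 v1]; apply: ler_pM; rewrite ?powR_ge0//.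
  by apply: ger_powR; [rewrite v0 ltW|rewrite lerD2r].
by apply: ger_powR; [lra|rewrite lerD2r].
Qed.

Lemma betaR_gt0 (a b : R) : 0 < a -> 0 < b -> 0 < betaR a b.
Proof.
(* On [1/4, 3/4] both v and 1 - v lie between 1/4 and 1. For such w, w^(e-1) >= w^e >= (1/4)^e;
   passing through the exponent e covers e < 1 as well. Hence [c] is a lower bound of the density
   there. *)
move=> a0 b0; pose c : R := 4%:R^-1 `^ a * 4%:R^-1 `^ b.
have c0 : 0 < c by rewrite mulr_gt0 ?powR_gt0.
have : (0 < (c * (1 - 4%:R^-1 - 4%:R^-1))%:E)%E.
  by rewrite lte_fin mulr_gt0//; lra.
rewrite -lte_fin EFin_betaR// => /lt_le_trans; apply.
have /= := @lebesgue_measure_itv R `[4%:R^-1, 1 - 4%:R^-1].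
rewrite lte_fin ifT; last by lra.
move=> hm.
apply: (@le_trans _ _ (\int[mu]_(v in `[(4%:R^-1)%R, (1 - 4%:R^-1)%R]) cst c%:E v)%E).
  by rewrite integral_cst//= EFinM hm -EFinD.
apply: (@le_trans _ _ (\int[mu]_(v in `[(4%:R^-1)%R, (1 - 4%:R^-1)%R])
    (beta_density a b v)%:E)%E).
  apply: ge0_le_integral_nonmeasurable => v /=; first by rewrite lee_fin ltW.
  rewrite in_itv/= lee_fin => /andP[h1 h2].
  have pw (w e : R) : 4%:R^-1 <= w <= 1 -> 0 < e -> 4%:R^-1 `^ e <= w `^ (e - 1).
    move=> /andP[w4 w1] e0; have w0 : 0 < w by rewrite (lt_le_trans _ w4).
    apply: (@le_trans _ _ (w `^ e)).
      by apply: ge0_ler_powR => //; rewrite ?nnegrE ltW.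
    by apply: ger_powR; rewrite ?w0//; lra.
  by apply: ler_pM; rewrite ?powR_ge0// pw//; lra.
apply: ge0_subset_integral => //.
- by apply/measurable_EFinP; exact: measurable_beta_density.
- by move=> v _; rewrite lee_fin beta_density_ge0.
- move=> v /=; rewrite !in_itv/=; lra.
Qed.

(** [powR_cvg0] is a limit from the right at 0, so the positivity of [lo01 n] enters when
    composing. *)
Lemma cvg_lo01_powR (c : R) : 0 < c ->
  (@lo01 R n) `^ c @[n --> \oo] --> (0 : R).
Proof.
move=> c0; apply: (cvg_comp (@lo01 R) (fun x => x `^ c) _ (powR_cvg0 c0)) => A.
move=> hA; have : \forall n \near \oo, 0 < lo01 n -> A (lo01 n) := cvg_lo01 hA.
by apply: (@filterS nat \oo) => n; apply; exact: lo01_gt0.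
Qed.

(** Integration by parts: [F] = v^a (1 - v)^b has derivative [P - Q] and vanishes at both ends of
    the interval. *)
Lemma betaR_parts (a b : R) : 0 < a -> 0 < b ->
  a * betaR a (b + 1) = b * betaR (a + 1) b.
Proof.
move=> a0 b0.
pose P (v : R) := a * beta_density a (b + 1) v.
pose Q (v : R) := b * beta_density (a + 1) b v.
pose F (v : R) := v `^ a * (1 - v) `^ b.
have ab1 : 0 < a + 1 by rewrite addr_gt0.
have bb1 : 0 < b + 1 by rewrite addr_gt0.
have mP (D : set R) : measurable_fun D P.
  by apply: measurable_funM => //; exact: measurable_beta_density.
have mQ (D : set R) : measurable_fun D Q.
  by apply: measurable_funM => //; exact: measurable_beta_density.
have P0 v : 0 <= P v by rewrite mulr_ge0 ?(ltW a0)// beta_density_ge0.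
have Q0 v : 0 <= Q v by rewrite mulr_ge0 ?(ltW b0)// beta_density_ge0.
have PE : (\int[mu]_(v in `]0%R, 1%R[) (P v)%:E = (a * betaR a (b + 1))%:E)%E.
  rewrite EFinM EFin_betaR//; under eq_integral do rewrite EFinM.
  rewrite ge0_integralZl ?lee_fin ?(ltW a0)//.
    by apply/measurable_EFinP; exact: measurable_beta_density.
  by move=> v _; rewrite lee_fin beta_density_ge0.
have QE : (\int[mu]_(v in `]0%R, 1%R[) (Q v)%:E = (b * betaR (a + 1) b)%:E)%E.
  rewrite EFinM EFin_betaR//; under eq_integral do rewrite EFinM.
  rewrite ge0_integralZl ?lee_fin ?(ltW b0)//.
    by apply/measurable_EFinP; exact: measurable_beta_density.
  by move=> v _; rewrite lee_fin beta_density_ge0.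
have iP : mu.-integrable `]0%R, 1%R[ (EFin \o P).
  apply/integrableP; split; first by apply/measurable_EFinP; exact: mP.
  rewrite (_ : integral _ _ _ = (a * betaR a (b + 1))%:E) ?ltry// -PE.
  by apply: eq_integral => v _; rewrite /= ger0_norm//; exact: P0.
have iQ : mu.-integrable `]0%R, 1%R[ (EFin \o Q).
  apply/integrableP; split; first by apply/measurable_EFinP; exact: mQ.
  rewrite (_ : integral _ _ _ = (b * betaR (a + 1) b)%:E) ?ltry// -QE.
  by apply: eq_integral => v _; rewrite /= ger0_norm//; exact: Q0.
have cP := cvg_integral_exhaustion (@lo01_mono R) (@exhaustion01 R) (mP _)
  (fun x _ => P0 x).
have cQ := cvg_integral_exhaustion (@lo01_mono R) (@exhaustion01 R) (mQ _)
  (fun x _ => Q0 x).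
have sub n (x : R) : lo01 n <= x <= hi01 n -> 0 < x < 1.
  by have := @lo01_gt0 R n; rewrite /hi01; lra.
have FTC n : (\int[mu]_(v in `[lo01 n, hi01 n]) (P v)%:E -
    \int[mu]_(v in `[lo01 n, hi01 n]) (Q v)%:E = (F (hi01 n) - F (lo01 n))%:E)%E.
  have subs : [set` `[@lo01 R n, hi01 n]] `<=` `]0%R, 1%R[%classic.
    by move=> x /=; rewrite !in_itv/=; exact: sub.
  rewrite -integralB_EFin//; [|exact: integrableS iP|exact: integrableS iQ].
  have dP (x : R) : 0 < x < 1 -> is_derive x 1 F (P x - Q x).
    move=> /andP[x0 x1].
    have h1 := is_derive1_powR a x0.
    have h2 := is_derive_powR_1B b x1.
    apply: (is_derive_eq (is_deriveM h1 h2)); rewrite /P /Q /beta_density !addrK /GRing.scale/=.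
    by ring.
  have dbeta (c e x : R) : 0 < x < 1 -> derivable (beta_density c e) x 1.
    move=> /andP[x0 x1].
    have h1 := is_derive1_powR (c - 1) x0.
    have h2 := is_derive_powR_1B (e - 1) x1.
    by apply: derivableM; exact: ex_derive.
  have dPQ (x : R) : 0 < x < 1 -> derivable (fun v => P v - Q v) x 1.
    move=> hx; apply: derivableB; apply: derivableM => //; exact: dbeta.
  by have <- := integral_itv_is_derive (lo01_lthi01 n)
    (fun x h => dP x (sub n x h)) (fun x h => dPQ x (sub n x h)).
have := cvgeB (FF := _) _ cP cQ; rewrite PE QE fin_num_adde_defr// => /(_ _ erefl) cPQ.
have : (F (hi01 n) - F (lo01 n))%:E @[n --> \oo] -->
    (a * betaR a (b + 1) - b * betaR (a + 1) b)%:E.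
  by move: cPQ; under eq_fun do rewrite FTC.
move=> /fine_cvgP[_]; rewrite /comp/= => c1.
suff c2 : F (hi01 n) - F (lo01 n) @[n --> \oo] --> (0 : R).
  by apply/eqP; rewrite -subr_eq0; apply/eqP; exact: cvg_unique c1 c2.
have F0 x : 0 <= F x by rewrite mulr_ge0 ?powR_ge0.
(* Since 1 - [hi01 n] = [lo01 n], the value of [F] is at most [lo01 n]^b at the right end and at
   most [lo01 n]^a at the left end. *)
rewrite -[X in _ --> X](subr0 0); apply: cvgB.
- apply: (squeeze_cvgr _ (cvg_cst 0) (cvg_lo01_powR b0)); near=> n.
  rewrite F0/= /F {2}/hi01 subKr ler_piMl ?powR_ge0// powR_le1// ?(ltW a0)//.
  by have := @lo01_gt0 R n; have := @lo01_lthi01 R n; rewrite /hi01; lra.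
- apply: (squeeze_cvgr _ (cvg_cst 0) (cvg_lo01_powR a0)); near=> n.
  rewrite F0/= /F ler_piMr ?powR_ge0// powR_le1// ?(ltW b0)//.
  by have := @lo01_gt0 R n; have := @lo01_lthi01 R n; rewrite /hi01; lra.
Unshelve. all: by end_near.
Qed.

Lemma betaR_split (a b : R) : 0 < a -> 0 < b ->
  betaR a b = betaR (a + 1) b + betaR a (b + 1).
Proof.
move=> a0 b0; apply: EFin_inj.
have a10 : 0 < a + 1 by rewrite addr_gt0.
have b10 : 0 < b + 1 by rewrite addr_gt0.
rewrite EFinD (EFin_betaR a0 b0) (EFin_betaR a10 b0) (EFin_betaR a0 b10).
rewrite -ge0_integralD//.
- apply: eq_integral => v; rewrite inE/= in_itv/= => hv.
  by rewrite -EFinD -beta_density_split.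
- by move=> v _; rewrite lee_fin beta_density_ge0.
- by apply/measurable_EFinP; exact: measurable_beta_density.
- by move=> v _; rewrite lee_fin beta_density_ge0.
- by apply/measurable_EFinP; exact: measurable_beta_density.
Qed.

(** The relations of [betaR_parts] and [betaR_split] form a linear system in B(a+1, b) and B(a,
    b+1), solved here for the first. *)
Lemma betaRSl (a b : R) : 0 < a -> 0 < b ->
  betaR (a + 1) b = a / (a + b) * betaR a b.
Proof.
move=> a0 b0; have ab0 : a + b != 0 by rewrite gt_eqF// addr_gt0.
move: (betaR_parts a0 b0) (betaR_split a0 b0).
move: (betaR a b) (betaR (a + 1) b) (betaR a (b + 1)) => x y z h ->.
by apply: (mulfI ab0); rewrite mulrA [_ * (a / _)]mulrC divfK// mulrDr h; ring.
Qed.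

Lemma betaRSr (a b : R) : 0 < a -> 0 < b ->
  betaR a (b + 1) = b / (a + b) * betaR a b.
Proof.
move=> a0 b0; have ab0 : a + b != 0 by rewrite gt_eqF// addr_gt0.
move: (betaR_parts a0 b0) (betaR_split a0 b0).
move: (betaR a b) (betaR (a + 1) b) (betaR a (b + 1)) => x y z h ->.
by apply: (mulfI ab0); rewrite mulrA [_ * (b / _)]mulrC divfK// mulrDr -h; ring.
Qed.

Lemma betaRSS (a b : R) : 0 < a -> 0 < b ->
  betaR (a + 1) (b + 1) = a * b / ((a + b) * (a + b + 1)) * betaR a b.
Proof.
move=> a0 b0; have a10 : 0 < a + 1 by rewrite addr_gt0.
have n1 : a + b != 0 by rewrite gt_eqF// addr_gt0.
have n2 : a + 1 + b != 0 by rewrite gt_eqF// addr_gt0.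
have n3 : a + b + 1 != 0 by rewrite gt_eqF// !addr_gt0.
rewrite (betaRSr a10 b0) (betaRSl a0 b0); move: (betaR a b) => x.
by field; rewrite n1 n3.
Qed.

End beta.

(** * Bounds on the likelihood *)

Section likelihood_bounds.
Context {R : realType}.

(** Lowering the shifts [s] and [t] to 1 can only increase the numerator; at shift 1, [betaRSS] with
    a + b = r gives the bound as an equality. *)
Lemma beta_ratio_le (s t r p q : R) : 1 <= s -> 1 <= t -> 0 < r ->
  0 < p -> 0 < q -> p + q = 1 ->
  betaR (s + r * p) (t + r * q) / betaR (r * p) (r * q) <=
    r / (1 + r) * (p * q).
Proof.
move=> s1 t1 r0 p0 q0 pq.
have rp0 : 0 < r * p by rewrite mulr_gt0.
have rq0 : 0 < r * q by rewrite mulr_gt0.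
rewrite ler_pdivrMr; last exact: betaR_gt0.
have h : betaR (s + r * p) (t + r * q) <= betaR (r * p + 1) (r * q + 1).
  by apply: betaR_le; rewrite ?addr_gt0// addrC lerD2r.
apply: (le_trans h); rewrite (betaRSS rp0 rq0).
have -> : r * p + r * q = r by rewrite -mulrDr pq mulr1.
rewrite le_eqVlt; apply/orP; left; apply/eqP; congr (_ * _).
by field; rewrite !gt_eqF// ?addr_gt0.
Qed.

(** Induction on [N] with [betaRSS]. The first shift produces the factor ab/(a+b); every later one
    acts on arguments that are at least 1 and bounded, so it costs only a constant. *)
Lemma betaR_addn_ge (N : nat) : exists2 c : R, 0 < c &
  forall a b, 0 < a -> 0 < b -> a + b <= 1 ->
  c * (a * b / (a + b)) * betaR a b <= betaR (a + N.+1%:R) (b + N.+1%:R).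
Proof.
elim: N => [|N [c c0 hc]].
  exists 2^-1; first by rewrite invr_gt0.
  move=> a b a0 b0 ab1; rewrite (betaRSS a0 b0).
  rewrite ler_pM2r ?betaR_gt0//.
  have ab0 : 0 < a + b by rewrite addr_gt0.
  rewrite mulrC -[leLHS]mulrA ler_pM2l ?mulr_gt0// -invfM.
  by rewrite lef_pV2 ?posrE ?mulr_gt0 ?addr_gt0// ler_pM2l//; lra.
(* With M = N + 1 and a + b <= 1, both a + b + 2M and a + b + 2M + 1 are at most 2(M + 1), so [d]
   bounds the denominator in [betaRSS]; the numerator is at least 1. *)
pose d : R := (2 * N.+2%:R) * (2 * N.+2%:R).
have d0 : 0 < d by rewrite !mulr_gt0.
exists (c / d); first by rewrite divr_gt0.
move=> a b a0 b0 ab1.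
set M : R := N.+1%:R.
have M1 : 1 <= M by rewrite ler1n.
have EM : N.+2%:R = M + 1 by rewrite -natr1.
have aM0 : 0 < a + M by lra.
have bM0 : 0 < b + M by lra.
rewrite EM !addrA (betaRSS aM0 bM0).
have B0 : 0 <= betaR (a + M) (b + M) by rewrite ltW// betaR_gt0.
have h : d^-1 <= (a + M) * (b + M) / ((a + M + (b + M)) * (a + M + (b + M) + 1)).
  rewrite ler_pdivlMr; last by rewrite mulr_gt0//; lra.
  rewrite mulrC ler_pdivrMr//.
  apply: (@le_trans _ _ d); last first.
    by rewrite ler_peMl ?(ltW d0)//; nra.
  by rewrite /d EM ler_pM//; lra.
apply: (@le_trans _ _ (d^-1 * betaR (a + M) (b + M))); last exact: ler_wpM2r.
have -> : c / d * (a * b / (a + b)) * betaR a b =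
    d^-1 * (c * (a * b / (a + b)) * betaR a b) by ring.
rewrite ler_pM2l ?invr_gt0//.
exact: hc.
Qed.

(** Both shifts, y and n - y, are at most n + 1, so monotonicity reduces to the equal shifts of
    [betaR_addn_ge]. With a = rp and b = rq, ab/(a+b) is rpq. *)
Lemma beta_ratio_ge (n : nat) : exists2 c : R, 0 < c &
  forall (y : nat) r p q, (1 <= y <= n - 1)%N -> 0 < r <= 1 ->
    0 < p -> 0 < q -> p + q = 1 ->
  c * (r * (p * q)) <=
    betaR (y%:R + r * p) (n%:R - y%:R + r * q) / betaR (r * p) (r * q).
Proof.
have [c c0 hc] := betaR_addn_ge n; exists c => // y r p q hy /andP[r0 r1] p0 q0 pq.
have rp0 : 0 < r * p by rewrite mulr_gt0.
have rq0 : 0 < r * q by rewrite mulr_gt0.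
rewrite ler_pdivlMr; last exact: betaR_gt0.
have rpq : r * p + r * q = r by rewrite -mulrDr pq mulr1.
have := hc _ _ rp0 rq0; rewrite rpq => /(_ r1) /le_trans h.
have -> : r * (p * q) = r * p * (r * q) / r by field; rewrite gt_eqF.
have yn : (y <= n)%N by case/andP: hy => _ /leq_trans; apply; exact: leq_subr.
apply: h; rewrite -natrB//.
have y0 : 1 <= y%:R :> R by rewrite ler1n; case/andP: hy.
have ny0 : 0 <= (n - y)%:R :> R by [].
apply: betaR_le; first by lra.
- by lra.
- by rewrite addrC lerD2l ler_nat (leq_trans yn).
- by rewrite addrC lerD2l ler_nat (leq_trans (leq_subr _ _)).
Qed.

(** * The likelihood between multiples of a function of [r] times a function of beta *)

Section likelihood.
Variables (k m : nat) (X : 'M[R]_(k, m)) (n y : 'I_k -> nat).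
Hypothesis interior : forall j, (1 <= y j <= n j - 1)%N.

Lemma pE_gt0 b j : 0 < pE X b j.
Proof. by rewrite divr_gt0 ?addr_gt0// expR_gt0. Qed.

Lemma qE_gt0 b j : 0 < qE X b j.
Proof.
rewrite subr_gt0 ltr_pdivrMr ?addr_gt0 ?expR_gt0// mul1r.
by rewrite -subr_gt0 addrK.
Qed.

(** This carries all the dependence on beta in both bounds on the likelihood. *)
Definition pq_prod (b : m.-tuple R) : R := \prod_(j < k) (pE X b j * qE X b j).

Lemma pq_prod_gt0 b : 0 < pq_prod b.
Proof. by apply: prodr_gt0 => j _; rewrite mulr_gt0 ?pE_gt0 ?qE_gt0. Qed.

Lemma likelihood_le : exists2 C : R, 0 < C & forall r b, 0 < r ->
  0 <= likelihood X n y r b <= C * (r / (1 + r)) ^+ k * pq_prod b.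
Proof.
have yn j : (y j <= n j)%N.
  by case/andP: (interior j) => _ /leq_trans; apply; exact: leq_subr.
exists (\prod_(j < k) 'C(n j, y j)%:R).
  by apply: prodr_gt0 => j _; rewrite ltr0n bin_gt0.
move=> r b r0.
have -> : (r / (1 + r)) ^+ k = \prod_(j < k) (r / (1 + r)).
  by rewrite prodr_const card_ord.
rewrite -!big_split/=.
have hj j : 0 <= betaR ((y j)%:R + r * pE X b j)
      ((n j)%:R - (y j)%:R + r * qE X b j) /
     betaR (r * pE X b j) (r * qE X b j) <=
     r / (1 + r) * (pE X b j * qE X b j).
  have p0 := pE_gt0 b j; have q0 := qE_gt0 b j.
  have rp0 : 0 < r * pE X b j by rewrite mulr_gt0.
  have rq0 : 0 < r * qE X b j by rewrite mulr_gt0.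
  have y1 : 1 <= (y j)%:R :> R by rewrite ler1n; case/andP: (interior j).
  have ny1 : 1 <= (n j)%:R - (y j)%:R :> R.
    rewrite -natrB// ler1n; have /andP[h1 h2] := interior j.
    (* The subtraction in [n j - 1] is truncated; [y j >= 1] excludes [n j = 0]. *)
    by rewrite subn_gt0 (leq_ltn_trans h2)// subn1 ltn_predL (leq_trans h1).
  apply/andP; split; last by apply: beta_ratio_le => //; rewrite addrC subrK.
  by rewrite divr_ge0 ?ltW// betaR_gt0//; lra.
apply/andP; split.
  by apply: prodr_ge0 => j _; rewrite mulr_ge0//; case/andP: (hj j).
apply: ler_prod => j _; have /andP[h1 h2] := hj j.
by rewrite mulr_ge0//= -mulrA ler_wpM2l.
Qed.

Lemma likelihood_ge : exists2 c : R, 0 < c & forall r b, 0 < r <= 1 ->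
  c * r ^+ k * pq_prod b <= likelihood X n y r b.
Proof.
have yn j : (y j <= n j)%N.
  by case/andP: (interior j) => _ /leq_trans; apply; exact: leq_subr.
have H j : exists c : R, 0 < c /\ forall (y : nat) r p q, (1 <= y <= n j - 1)%N ->
    0 < r <= 1 -> 0 < p -> 0 < q -> p + q = 1 ->
    c * (r * (p * q)) <=
    betaR (y%:R + r * p) ((n j)%:R - y%:R + r * q) / betaR (r * p) (r * q).
  by have [c c0 hc] := beta_ratio_ge (n j); exists c.
(* The constant depends on [n j], hence on the group; one is chosen for each. *)
have [c hc] := choice H.
exists (\prod_(j < k) c j); first by apply: prodr_gt0 => j _; case: (hc j).
move=> r b hr; have /andP[r0 _] := hr.
have -> : r ^+ k = \prod_(j < k) r by rewrite prodr_const card_ord.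
rewrite -!big_split/=; apply: ler_prod => j _.
have [c0 /(_ (y j) r (pE X b j) (qE X b j) (interior j) hr)] := hc j.
have p0 := pE_gt0 b j; have q0 := qE_gt0 b j.
have -> : pE X b j + qE X b j = 1 by rewrite addrC subrK.
move=> /(_ p0 q0 erefl) h; apply/andP; split.
  by rewrite !mulr_ge0// ltW.
(* The binomial coefficient is at least 1 and is dropped. *)
rewrite -mulrA; apply: (le_trans h); apply: ler_peMl.
  by apply: le_trans h; rewrite !mulr_ge0// ltW.
by rewrite ler1n bin_gt0.
Qed.

End likelihood.
End likelihood_bounds.

(** * One-dimensional integrals *)

Section one_dimensional_integrals.
Context {R : realType}.
Local Notation mu := (@lebesgue_measure R).

Lemma is_derive_inv1D (r : R) : 0 < r ->
  is_derive r 1 (fun r => (1 + r)^-1) (- ((1 + r)^-1 ^+ 2)).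
Proof.
move=> r0; have n0 : 1 + r != 0 by rewrite gt_eqF// addr_gt0.
have h := is_deriveD (is_derive_cst (1 : R) r 1) (is_derive_id r 1).
apply: (is_derive_eq (is_deriveV (f := fun r : R => 1 + r) n0 h)).
by rewrite add0r /GRing.scale/= mulr1 exprVn.
Qed.

(* With [z = r / (1 + r)], the integrand is [beta_density a u z] times the
   derivative of [z]. *)
Lemma radial_integrandE (k : nat) (a u r : R) : k%:R = a + u -> 0 < r ->
  1 / r `^ (u + 1) * (r / (1 + r)) ^+ k =
  beta_density a u (1 - (1 + r)^-1) * (1 + r)^-1 ^+ 2.
Proof.
move=> kau r0; have r1 : 0 < 1 + r by rewrite addr_gt0.
have i0 : 0 < (1 + r)^-1 by rewrite invr_gt0.
have z0 : 0 < r / (1 + r) by rewrite divr_gt0.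
have -> : 1 - (1 + r)^-1 = r / (1 + r) by field; rewrite gt_eqF.
have -> : 1 / r `^ (u + 1) = (r / (1 + r)) `^ (- (u + 1)) * (1 + r)^-1 `^ (u + 1).
  rewrite powRM ?ltW// -mulrA -powRDgt0// addNr powRr0 mulr1 div1r powRN//.
rewrite /beta_density.
have -> : 1 - r / (1 + r) = (1 + r)^-1 by field; rewrite gt_eqF.
rewrite -!powR_mulrn ?(ltW z0) ?(ltW i0)// mulrAC -powRDgt0// -mulrA -powRDgt0//.
by congr (_ `^ _ * _ `^ _); [rewrite kau; ring | ring].
Qed.

Lemma exhaustion_pos : `]0, +oo[%classic =
  \bigcup_n `[n.+2%:R^-1, n.+2%:R]%classic :> set R.
Proof.
apply/seteqP; split=> x /=.
  rewrite in_itv/= andbT => x0.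
  (* This exceeds both x and 1/x after adding 1, which places x in the interval. *)
  pose N := Num.truncn (x + x^-1).
  have hN : x + x^-1 < N.+1%:R by exact: truncnS_gt.
  have N2 : N.+1%:R <= N.+2%:R :> R by rewrite ler_nat.
  have xi0 : 0 < x^-1 by rewrite invr_gt0.
  exists N => //=; rewrite in_itv/=; apply/andP; split; last by lra.
  by rewrite invf_ple ?posrE//; lra.
move=> [n _] /=; rewrite !in_itv/= andbT => /andP[h1 _].
by rewrite (lt_le_trans _ h1)// invr_gt0.
Qed.

(** The substitution z = r/(1+r) turns the integral into that of the beta density with parameters k
    - u and u. The constant [K] does not depend on [A], which will later depend on beta. *)
Lemma radial_integral_le (k : nat) (u : R) : 0 < u -> u < k%:R ->
  exists2 K : R, 0 < K & forall A, 0 <= A ->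
  (\int[mu]_(r in `]0%R, +oo[) (A * (1 / r `^ (u + 1) * (r / (1 + r)) ^+ k))%:E
    <= (A * K)%:E)%E.
Proof.
move=> u0 uk; pose a := k%:R - u.
have a0 : 0 < a by rewrite subr_gt0.
have ka : k%:R = a + u by rewrite subrK.
exists (a^-1 + u^-1); first by rewrite addr_gt0 ?invr_gt0.
move=> A A0.
pose z (r : R) := 1 - (1 + r)^-1.
(* The antiderivative of the majorant in [beta_density_le], composed with [z]; note 1 - z =
   1/(1+r). *)
pose F (r : R) := A *: (a^-1 * z r `^ a - u^-1 * (1 + r)^-1 `^ u).
pose f (r : R) := A *: ((z r `^ (a - 1) + (1 + r)^-1 `^ (u - 1)) * ((1 + r)^-1 * (1 + r)^-1)).
have i01 (r : R) : 0 < r -> 0 < (1 + r)^-1 < 1.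
  by move=> r0; rewrite invr_gt0 addr_gt0//= invf_lt1 ?addr_gt0//; lra.
have z01 (r : R) : 0 < r -> 0 < z r < 1 by move=> /i01; rewrite /z; lra.
have dz (r : R) : 0 < r -> is_derive r 1 z ((1 + r)^-1 ^+ 2).
  move=> /is_derive_inv1D h.
  apply: (is_derive_eq (is_deriveB (is_derive_cst (1 : R) r 1) h)).
  by rewrite sub0r opprK.
have dzp (r c : R) : 0 < r ->
    is_derive r 1 (fun r => z r `^ c) (c * z r `^ (c - 1) * (1 + r)^-1 ^+ 2).
  move=> r0; have /andP[z0 _] := z01 _ r0.
  exact: (is_derive1_comp (is_derive1_powR c z0) (dz r r0)).
have dip (r c : R) : 0 < r -> is_derive r 1 (fun r => (1 + r)^-1 `^ c)
    (c * (1 + r)^-1 `^ (c - 1) * - ((1 + r)^-1 ^+ 2)).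
  move=> r0; have /andP[i0 _] := i01 _ r0.
  exact: (is_derive1_comp (g := fun r : R => (1 + r)^-1) (is_derive1_powR c i0) (is_derive_inv1D r0)).
apply: (@le_trans _ _ (\int[mu]_(r in `]0%R, +oo[) (f r)%:E)%E).
  apply: ge0_le_integral_nonmeasurable => r /=; rewrite in_itv/= andbT lee_fin => r0.
    by rewrite !mulr_ge0 ?invr_ge0 ?powR_ge0// exprn_ge0// divr_ge0 ?addr_ge0// ltW.
  rewrite (radial_integrandE ka r0) /f /GRing.scale/=; apply: ler_wpM2l => //.
  rewrite expr2; have /andP[i0 _] := i01 _ r0.
  apply: ler_wpM2r; first by rewrite mulr_ge0 ?ltW.
  have := beta_density_le a0 u0 (z01 _ r0).
  by rewrite {3}/z subKr.
apply: (@ge0_integral_is_derive_le _ _ (fun n => n.+2%:R^-1) (fun n => n.+2%:R) F).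
- by move=> n m nm; rewrite lef_pV2 ?posrE ?ltr0n// !ler_nat !ltnS.
- by move=> n; rewrite (@lt_trans _ _ 1) ?invf_lt1 ?ltr1n.
- exact: exhaustion_pos.
- move=> r /=; rewrite in_itv/= andbT => /i01/andP[/ltW i0 _].
  by rewrite /f /GRing.scale/= !mulr_ge0 ?addr_ge0 ?powR_ge0.
- move=> r /=; rewrite in_itv/= andbT => r0.
  apply: (is_derive_eq (is_deriveZ A (is_deriveB (is_deriveZ a^-1 (dzp r a r0))
    (is_deriveZ u^-1 (dip r u r0))))).
  rewrite /f /GRing.scale/=; move: (z r `^ _) (_ `^ (u - 1)) => x y.
  by field; rewrite !gt_eqF//= addr_gt0.
- move=> r /=; rewrite in_itv/= andbT => r0.
  have h1 := dzp r (a - 1) r0; have h2 := dip r (u - 1) r0.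
  have h3 := is_derive_inv1D r0.
  by apply: derivableZ; apply: derivableM; [apply: derivableD|apply: derivableM];
    exact: ex_derive.
- move=> n; rewrite /F -scalerBr /GRing.scale/=; apply: ler_wpM2l => //.
  have n0 : 0 < n.+2%:R :> R by [].
  have ni0 : 0 < n.+2%:R^-1 :> R by rewrite invr_gt0.
  have h1 : a^-1 * z n.+2%:R `^ a <= a^-1.
    rewrite ler_piMr ?invr_ge0 ?(ltW a0)//; apply: powR_le1 (ltW a0).
    by have /andP[-> /ltW] := z01 _ n0.
  have h2 : u^-1 * (1 + n.+2%:R^-1)^-1 `^ u <= u^-1.
    rewrite ler_piMr ?invr_ge0 ?(ltW u0)//; apply: powR_le1 (ltW u0).
    by have /andP[-> /ltW] := i01 _ ni0.
  have h3 : 0 <= a^-1 * z n.+2%:R^-1 `^ a by rewrite mulr_ge0 ?invr_ge0 ?powR_ge0 ?ltW.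
  have h4 : 0 <= u^-1 * (1 + n.+2%:R)^-1 `^ u by rewrite mulr_ge0 ?invr_ge0 ?powR_ge0 ?ltW.
  lra.
Qed.

Lemma integral_inv01 (A : R) : 0 < A ->
  (\int[mu]_(r in `]0%R, 1%R[) (A * r^-1)%:E = +oo)%E.
Proof.
move=> A0; apply/eqyP => M M0.
(* The integral over the n-th interval is A ln([hi01 n] / [lo01 n]) = A ln(n + 2), which exceeds M
   once n + 1 > exp(M/A). *)
pose n := Num.truncn (expR (M / A)).
have hn : expR (M / A) < n.+1%:R by exact: truncnS_gt.
have lo0 := @lo01_gt0 R n.
have hi0 : 0 < hi01 n :> R by rewrite (lt_trans lo0)// lo01_lthi01.
apply: (@le_trans _ _ (\int[mu]_(r in `[lo01 n, hi01 n]) (A * r^-1)%:E)%E).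
  have dln (x : R) : lo01 n <= x <= hi01 n ->
      is_derive x 1 (A \*: (@ln R)) (A * x^-1).
    move=> /andP[/(lt_le_trans lo0) x0 _].
    exact: (is_deriveZ A (is_derive1_ln x0)).
  have dinv (x : R) : lo01 n <= x <= hi01 n -> derivable (fun r : R => A * r^-1) x 1.
    move=> /andP[/(lt_le_trans lo0) x0 _].
    apply: derivableM => //; apply: derivableV => //; by rewrite gt_eqF.
  have -> := integral_itv_is_derive (lo01_lthi01 n) dln dinv.
  rewrite lee_fin /GRing.scale/= -mulrBr -ln_div ?posrE//.
  rewrite mulrC -ler_pdivrMr// -[leLHS]expRK ler_ln ?posrE ?expR_gt0 ?divr_gt0//.
  rewrite (le_trans (ltW hn))// /hi01 mulrBl mul1r divff ?gt_eqF// /lo01 invrK.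
  by rewrite lerBrDr natr1 ler_nat.
apply: ge0_le_integral_subset => x /=.
- rewrite !in_itv/= /hi01 => /andP[h1 h2]; by apply/andP; split; lra.
- rewrite in_itv/= => /andP[h1 _].
  by rewrite lee_fin mulr_ge0 ?invr_ge0 ?ltW// (lt_le_trans lo0 h1).
- by [].
- rewrite in_itv/= => /andP[h1 _].
  by rewrite lee_fin mulr_ge0 ?invr_ge0 ?ltW.
Qed.

(** * The logistic density and its exponential tails *)

(** The density of the standard logistic distribution, equal to p(1 - p) for p = exp(t)/(1 +
    exp(t)). *)
Definition logistic_density (t : R) : R := expR t / (1 + expR t) ^+ 2.

(** 1 + exp(t) is at most 2 exp(t) for t >= 0, and at most 2 for t < 0. *)
Lemma logistic_density_ge (t : R) : expR (- `|t|) <= 4 * logistic_density t.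
Proof.
have e0 := expR_gt0 t.
rewrite mulrA ler_pdivlMr ?exprn_gt0 ?addr_gt0//.
have [t0|t0] := leP 0 t.
  have e1 : 1 <= expR t by rewrite -expR0 ler_expR.
  rewrite ger0_norm// expRN mulrC ler_pdivrMr//; nra.
have e1 : expR t <= 1 by rewrite -expR0 ler_expR ltW.
by rewrite ltr0_norm// opprK mulrC; nra.
Qed.

Lemma logistic_density_le (t : R) : logistic_density t <= expR (- `|t|).
Proof.
have e0 := expR_gt0 t.
rewrite ler_pdivrMr ?exprn_gt0 ?addr_gt0//.
have [t0|t0] := leP 0 t.
  rewrite ger0_norm// expRN mulrC ler_pdivlMr//; nra.
by rewrite ltr0_norm// opprK; nra.
Qed.

Lemma pE_qE_logistic k m (X : 'M[R]_(k, m)) b j :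
  pE X b j * qE X b j = logistic_density (linpred X b j).
Proof.
rewrite /qE /pE /logistic_density; field.
by rewrite gt_eqF// addr_gt0// expR_gt0.
Qed.

Lemma exhaustionT : [set: R] =
  \bigcup_n [set` `[- n.+1%:R, n.+1%:R]] :> set R.
Proof.
apply/seteqP; split=> x //= _; exists (Num.truncn `|x|) => //=.
by rewrite in_itv/= -ler_norml ltW// truncnS_gt.
Qed.

(** The majorant 4 [logistic_density] (ct) is smooth and has the bounded antiderivative [F], so the
    kink of the absolute value at 0 needs no case split. *)
Lemma integral_expRN_norm_lty (c : R) : 0 < c ->
  (\int[mu]_t (expR (- (c * `|t|)))%:E < +oo)%E.
Proof.
move=> c0.
pose e (t : R) := expR (c * t).
pose f (t : R) := 4 *: (e t * ((1 + e t)^-1 * (1 + e t)^-1)).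
pose F (t : R) := (- (4 / c)) *: (1 + e t)^-1.
have e0 t : 0 < e t by exact: expR_gt0.
have n0 t : 1 + e t != 0 by rewrite gt_eqF// addr_gt0.
apply: (@le_lt_trans _ _ (\int[mu]_t (f t)%:E)%E).
  apply: ge0_le_integral_nonmeasurable => t _; rewrite lee_fin ?expR_ge0//.
  have := logistic_density_ge (c * t).
  by rewrite normrM (gtr0_norm c0) /logistic_density expr2 invfM.
apply: (@le_lt_trans _ _ (4 / c)%:E); last by rewrite ltry.
have de (t : R) : is_derive t 1 e (e t * c).
  have h : is_derive t 1 (fun t : R => c * t) c.
    by apply: (is_derive_eq (is_deriveZ c (is_derive_id t 1))); rewrite /GRing.scale/= mulr1.
  exact: (is_derive1_comp (is_derive_expR _) h).
have dV (t : R) : is_derive t 1 (fun t => (1 + e t)^-1) (- ((1 + e t) ^- 2 * (e t * c))).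
  have h := is_deriveD (is_derive_cst (1 : R) t 1) (de t).
  apply: (is_derive_eq (is_deriveV (f := fun t => 1 + e t) (n0 t) h)).
  by rewrite add0r /GRing.scale/= mulNr.
apply: (@ge0_integral_is_derive_le _ _ (fun n => - n.+1%:R) (fun n => n.+1%:R) F).
- by move=> n m nm; rewrite lerN2 !ler_nat !ltnS.
- by move=> n; rewrite gtrN.
- exact: exhaustionT.
- by move=> t _; rewrite /f /GRing.scale/= !mulr_ge0 ?invr_ge0 ?addr_ge0 ?ltW.
- move=> t _; apply: (is_derive_eq (is_deriveZ _ (dV t))).
  rewrite /f /GRing.scale/=; have := n0 t; move: (e t) => x x1.
  by field; rewrite x1 gt_eqF.
- move=> t _; have h1 := de t; have h2 := dV t.
  by apply: derivableZ; apply: derivableM; [|apply: derivableM]; exact: ex_derive.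
- move=> n; rewrite /F -scalerBr /GRing.scale/= mulNr -mulrN opprB.
  rewrite ler_piMr ?divr_ge0 ?(ltW c0)//.
  have h1 : 0 <= (1 + e n.+1%:R)^-1 by rewrite invr_ge0 addr_ge0 ?ltW.
  have h2 : (1 + e (- n.+1%:R))^-1 <= 1.
    by rewrite invf_le1 ?addr_gt0//; have := e0 (- n.+1%:R); lra.
  lra.
Qed.

End one_dimensional_integrals.

(** * Lebesgue measure on tuples *)

Section tuple_measure.
Context {R : realType}.
Local Notation mu := (@lebesgue_measure R).
Local Notation T := (measurableTypeR R).

Definition cube (m : nat) (c : 'I_m -> R) : set (m.-tuple T) :=
  [set t | forall l, c l <= tnth t l <= c l + 1].

Lemma measurable_cube m (c : 'I_m -> R) : measurable (cube c).
Proof.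
rewrite (_ : cube c = \bigcap_(l in [set: 'I_m])
    ((fun t : m.-tuple T => tnth t l) @^-1` [set` `[c l, c l + 1]])).
  apply: fin_bigcap_measurable => [|l _]; first exact: finite_finset.
  by rewrite -[X in measurable X]setTI; apply: measurable_tnth.
apply/seteqP; split=> t /=.
  by move=> h l _ /=; rewrite in_itv/=.
by move=> h l; have := h l Logic.I; rewrite /= in_itv.
Qed.

Lemma tnth_consp0 m (x : T) (t : m.-tuple T) : tnth (consp (x, t)) ord0 = x.
Proof. by []. Qed.

Lemma tnth_consp_lift m (x : T) (t : m.-tuple T) (l : 'I_m) :
  tnth (consp (x, t)) (lift ord0 l) = tnth t l.
Proof. by rewrite !(tnth_nth x). Qed.

(** By induction: undoing [consp] splits a cube into an interval of length 1 and a cube of one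
    dimension less. In dimension 0 the measure is a point mass. *)
Lemma lebesgue_cube m (c : 'I_m -> R) : lebesgue_measure_tuple R m (cube c) = 1%E.
Proof.
elim: m c => [|m IH] c.
  rewrite /= diracE mem_set//; by case.
rewrite /= /cons_measure /pushforward.
rewrite (_ : _ @^-1` _ = `[c ord0, c ord0 + 1] `*` cube (c \o lift ord0)).
  rewrite product_measure1E//; last exact: measurable_cube.
  by rewrite IH mule1 /= lebesgue_measure_itv/= lte_fin ltrDl ltr01 -EFinD addrAC subrr add0r.
apply/seteqP; split=> -[x t] /=.
  move=> h; split; first by have := h ord0; rewrite /= in_itv.
  move=> l; have := h (lift ord0 l).
  by rewrite tnth_consp_lift.
move=> [h1 h2] l; have [j ->|->] := unliftP ord0 l.
  by rewrite tnth_consp_lift; exact: h2.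
by move: h1; rewrite in_itv.
Qed.

Lemma measurable_prod_tnth m (h : R -> R) : measurable_fun setT h ->
  measurable_fun [set: m.-tuple T] (fun t => \prod_(l < m) h (tnth t l)).
Proof.
move=> mh; apply: measurable_prod => l _.
by apply: (measurableT_comp mh); exact: measurable_tnth.
Qed.

(** Tonelli and induction on [m]: the integral is the one-dimensional integral times the integral in
    one dimension less. *)
Lemma integral_prod_lty m (h : R -> R) : measurable_fun setT h ->
  (forall x, 0 <= h x) -> (\int[mu]_x (h x)%:E < +oo)%E ->
  (\int[lebesgue_measure_tuple R m]_t (\prod_(l < m) h (tnth t l))%:E < +oo)%E.
Proof.
move=> mh h0 hoo; elim: m => [|m IH].
  rewrite /= integral_dirac//; last by apply/measurable_EFinP; exact: measurable_prod_tnth.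
  by rewrite diracE in_setT mul1e ltry.
have p0 n (t : n.-tuple T) : 0 <= \prod_(l < n) h (tnth t l).
  by apply: prodr_ge0.
have mp n : measurable_fun [set: n.-tuple T] (fun t => (\prod_(l < n) h (tnth t l))%:E).
  by apply/measurable_EFinP; exact: measurable_prod_tnth.
(* Unfolds the measure on (m+1)-tuples to an image measure, for the change of variables. *)
rewrite [X in (X < _)%E](_ : _ = \int[pushforward (mu \x lebesgue_measure_tuple R m)%E
  (@consp _ T m)]_t (\prod_(l < m.+1) h (tnth t l))%:E)%E//.
have mc : measurable_fun setT (@consp _ T m) by exact: measurable_consp.
rewrite (ge0_integral_pushforward mc _ measurableT (mp m.+1)); last by move=> t _; rewrite lee_fin.
rewrite preimage_setT fubini_tonelli1//; last 2 first.
- exact: (measurableT_comp (mp m.+1) mc).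
- by move=> z; rewrite /comp lee_fin; exact: p0.
rewrite /fubini_F.
pose A : \bar R := (\int[lebesgue_measure_tuple R m]_t (\prod_(l < m) h (tnth t l))%:E)%E.
have A0 : (0 <= A)%E by apply: integral_ge0 => t _; rewrite lee_fin.
have Afin : A \is a fin_num by rewrite ge0_fin_numE.
rewrite (_ : (\int[_]_x _)%E = \int[mu]_x ((fine A)%:E * (h x)%:E))%E; last first.
  apply: eq_integral => x _ /=.
  transitivity (\int[lebesgue_measure_tuple R m]_t
      ((h x)%:E * (\prod_(l < m) h (tnth t l))%:E))%E.
    apply: eq_integral => t _; rewrite -EFinM big_ord_recl tnth_consp0.
    by congr (_ * _)%:E; apply: eq_bigr => l _; rewrite tnth_consp_lift.
  rewrite (ge0_integralZl _ _ (mp m)) ?lee_fin//.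
    by rewrite -/A muleC; congr (_ * _)%E; rewrite fineK.
  by move=> t _; rewrite lee_fin.
rewrite ge0_integralZl//.
- by rewrite lte_mul_pinfty// ?lee_fin ?fine_ge0.
- by apply/measurable_EFinP.
- by move=> x _; rewrite lee_fin.
- by rewrite lee_fin fine_ge0.
Qed.

End tuple_measure.

(** * The posterior *)

Section rank.
Context {R : realType}.
Variables (k m : nat) (X : 'M[R]_(k, m)).

(** Full column rank provides a left inverse [L] of [X], so b = L(Xb) is controlled by Xb. *)
Lemma sum_norm_linpred_ge : \rank X = m -> exists2 c : R, 0 < c &
  forall b : m.-tuple R,
    c * \sum_(l < m) `|tnth b l| <= \sum_(j < k) `|linpred X b j|.
Proof.
move=> rX; have /row_fullP[L LX] : row_full X by rewrite /row_full rX.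
(* The summand 1 makes [M] invertible whatever the entries of [L]. *)
pose M : R := 1 + \sum_(l < m) \sum_(j < k) `|L l j|.
have M0 : 0 < M by rewrite ltr_pwDl// !sumr_ge0// => l _; exact: sumr_ge0.
exists M^-1; first by rewrite invr_gt0.
move=> b; set S := \sum_(j < k) _; rewrite mulrC ler_pdivrMr//.
have S0 : 0 <= S by exact: sumr_ge0.
have linS j : `|linpred X b j| <= S.
  by rewrite /S (bigD1 j)//= lerDl sumr_ge0.
have bE l : tnth b l = \sum_(j < k) L l j * linpred X b j.
  pose bc : 'cV[R]_m := \col_l tnth b l.
  have := congr1 (fun A : 'cV[R]_m => A l ord0) (mulmxA L X bc).
  rewrite LX mul1mx !mxE => <-; apply: eq_bigr => j _; congr (_ * _).
  by rewrite mxE; apply: eq_bigr => i _; rewrite mxE.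
apply: (@le_trans _ _ (\sum_(l < m) \sum_(j < k) `|L l j| * S)).
  apply: ler_sum => l _; rewrite bE; apply: (le_trans (ler_norm_sum _ _ _)).
  by apply: ler_sum => j _; rewrite normrM ler_wpM2l.
under eq_bigr do rewrite -mulr_suml.
by rewrite -mulr_suml mulrC ler_wpM2l// lerDr.
Qed.

Lemma pq_prod_le : \rank X = m -> exists2 c : R, 0 < c &
  forall b : m.-tuple R,
    pq_prod X b <= \prod_(l < m) expR (- (c * `|tnth b l|)).
Proof.
move=> /sum_norm_linpred_ge[c c0 hc]; exists c => // b.
apply: (@le_trans _ _ (\prod_(j < k) expR (- `|linpred X b j|))).
  apply: ler_prod => j _; rewrite mulr_ge0 ?(ltW (pE_gt0 _ _ _)) ?(ltW (qE_gt0 _ _ _))//=.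
  by rewrite pE_qE_logistic logistic_density_le.
rewrite -!expR_sum ler_expR !sumrN lerN2 -mulr_sumr; exact: hc.
Qed.

(** Rank below [m] gives a nonzero kernel vector; it is scaled to have a coordinate 1, along which
    cubes at even multiples of it are separated. *)
Lemma kernel_vector : \rank X <> m -> exists (v : 'I_m -> R) (l0 : 'I_m),
  v l0 = 1 /\ forall j, \sum_(l < m) X j l * v l = 0.
Proof.
move=> rX; have : kermx X^T != 0.
  rewrite -mxrank_eq0 mxrank_ker mxrank_tr subn_eq0 -ltnNge ltn_neqAle.
  by rewrite rank_leq_col andbT; apply/eqP.
move=> /rowV0Pn[w /sub_kermxP wX] /rV0Pn[l0 wl0].
exists (fun l => w 0 l / w 0 l0), l0; split; first by rewrite divff.
move=> j; under eq_bigr do rewrite mulrA.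
rewrite -mulr_suml (_ : \sum_(l < m) _ = 0) ?mul0r//.
have := congr1 (fun A : 'rV[R]_k => A 0 j) wX; rewrite !mxE; apply: etrans.
by apply: eq_bigr => l _; rewrite mxE mulrC.
Qed.

(** Since Xv = 0, subtracting 2N v from b leaves Xb unchanged and moves b into the cube [0, 1]^m, so
    the linear predictors are bounded uniformly in [N]. *)
Lemma pq_prod_ge_cubes (v : 'I_m -> R) :
  (forall j, \sum_(l < m) X j l * v l = 0) -> exists2 d : R, 0 < d &
  forall (N : nat) b, cube (fun l => (2 * N)%:R * v l) b -> d <= pq_prod X b.
Proof.
move=> Xv; exists (\prod_(j < k) (expR (- \sum_(l < m) `|X j l|) / 4)).
  by apply: prodr_gt0 => j _; rewrite divr_gt0 ?expR_gt0.
move=> N b hb; apply: ler_prod => j _.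
rewrite divr_ge0 ?expR_ge0//= pE_qE_logistic ler_pdivrMr// mulrC.
apply: le_trans (logistic_density_ge _); rewrite ler_expR lerN2.
have -> : linpred X b j = \sum_(l < m) X j l * (tnth b l - (2 * N)%:R * v l).
  under [RHS]eq_bigr do rewrite mulrBr mulrCA.
  by rewrite sumrB -mulr_sumr Xv mulr0 subr0.
apply: (le_trans (ler_norm_sum _ _ _)); apply: ler_sum => l _.
rewrite normrM ler_piMr// ler_norml; have /andP[h1 h2] := hb l.
by apply/andP; split; lra.
Qed.

Lemma lebesgue_cubes (v : 'I_m -> R) (l0 : 'I_m) : v l0 = 1 ->
  lebesgue_measure_tuple R m
    (\bigcup_N cube (fun l => (2 * N)%:R * v l)) = +oo%E.
Proof.
move=> vl0; rewrite measure_bigcup//; last 2 first.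
- by move=> N _; exact: measurable_cube.
- move=> N M _ _ [t [/(_ l0) + /(_ l0)]]; rewrite vl0 !mulr1.
  move=> /andP[h1 h2] /andP[h3 h4].
  (* A common point of two cubes has its [l0] coordinate in both [2N, 2N+1] and [2M, 2M+1]; applying
     this in both directions gives N = M. *)
  have le N' M' : (2 * N')%:R <= tnth t l0 -> tnth t l0 <= (2 * M')%:R + 1 ->
      (N' <= M')%N.
    move=> g1 g2; have : (2 * N')%:R <= (2 * M').+1%:R :> R.
      by rewrite -natr1 (le_trans g1).
    by rewrite ler_nat !mul2n leq_Sdouble.
  by apply/eqP; rewrite eqn_leq !le.
apply/eqyP => M M0; pose n := (Num.truncn M).+1.
apply: le_trans (nneseries_lim_ge n _); last by move=> *; exact: measure_ge0.
rewrite (eq_bigr (fun=> 1%E)); last by move=> N _; exact: lebesgue_cube.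
rewrite (eq_bigl xpredT); last by move=> N; rewrite in_setT.
rewrite sumEFin lee_fin big_const_nat subn0 iter_addr addr0.
by rewrite ltW// truncnS_gt.
Qed.

End rank.

(** * Propriety and impropriety *)

Section posterior.
Context {R : realType}.
Local Notation mu := (@lebesgue_measure R).
Variables (k m : nat) (X : 'M[R]_(k, m)) (n y : 'I_k -> nat).
Hypothesis interior : forall j, (1 <= y j <= n j - 1)%N.
Variables (u : R) (prior : R -> m.-tuple R -> R).
Hypothesis u0 : 0 < u.
Hypothesis hprior : proportional prior (fun r _ => 1 / r `^ (u + 1)).

Lemma prior_likelihood_ge0 r b : 0 < r -> 0 <= prior r b * likelihood X n y r b.
Proof.
move=> r0; have [c c0 hc] := hprior; rewrite hc//.
have [C _ /(_ r b r0)/andP[L0 _]] := likelihood_le X interior.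
by rewrite mulr_ge0// mulr_ge0 ?(ltW c0)// divr_ge0 ?powR_ge0.
Qed.

Lemma proper_of_full_rank :
  u < k%:R -> \rank X = m -> posterior_proper X n y prior.
Proof.
move=> uk rX; have [c c0 hc] := hprior.
have [C C0 hC] := likelihood_le X interior.
have [K K0 hK] := radial_integral_le u0 uk.
have [e e0 he] := pq_prod_le rX.
pose h (x : R) := expR (- (e * `|x|)).
have mh : measurable_fun setT h.
  apply: measurableT_comp => //; apply: measurableT_comp => //.
  by apply: measurable_funM => //; exact: measurable_normr.
have h0 x : 0 <= h x by exact: expR_ge0.
have cC0 : 0 <= c * C by rewrite mulr_ge0 ?ltW.
have ccK0 : 0 <= c * C * K by rewrite mulr_ge0 ?(ltW K0).
apply: (@le_lt_trans _ _ (\int[lebesgue_measure_tuple R m]_b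
    ((c * C * K)%:E * (\prod_(l < m) h (tnth b l))%:E))%E).
  apply: ge0_le_integral_nonmeasurable => b _.
    apply: integral_ge0 => r /=; rewrite in_itv/= andbT lee_fin.
    exact: prior_likelihood_ge0.
  have G0 := pq_prod_gt0 X b.
  (* For fixed [b] the factor in front of the radial integral plays the role of [A]. *)
  apply: (@le_trans _ _ ((c * C * pq_prod X b) * K)%:E); last first.
    rewrite -EFinM lee_fin [leLHS]mulrAC ler_wpM2l//; exact: he.
  apply: le_trans (hK (c * C * pq_prod X b) _); last first.
    by rewrite mulr_ge0// ltW.
  apply: ge0_le_integral_nonmeasurable => r /=; rewrite in_itv/= andbT lee_fin => r0.
    exact: prior_likelihood_ge0.
  rewrite hc//; have /andP[_ hL] := hC r b r0.
  apply: (@le_trans _ _ (c * (1 / r `^ (u + 1)) *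
    (C * (r / (1 + r)) ^+ k * pq_prod X b))).
    by rewrite ler_wpM2l// mulr_ge0 ?(ltW c0)// divr_ge0 ?powR_ge0.
  by rewrite le_eqVlt; apply/orP; left; apply/eqP; ring.
rewrite ge0_integralZl ?lee_fin//.
- rewrite lte_mul_pinfty ?lee_fin//.
  by apply: integral_prod_lty => //; exact: integral_expRN_norm_lty.
- by apply/measurable_EFinP; exact: measurable_prod_tnth.
- by move=> b _; rewrite lee_fin prodr_ge0.
Qed.

Lemma prior_likelihood_ge : exists2 c : R, 0 < c & forall r b, 0 < r <= 1 ->
  c * pq_prod X b * (r ^+ k / r `^ (u + 1)) <= prior r b * likelihood X n y r b.
Proof.
have [c c0 hc] := hprior; have [d d0 hd] := likelihood_ge X interior.
exists (c * d); first by rewrite mulr_gt0.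
move=> r b hr; have /andP[r0 _] := hr; rewrite hc//.
apply: (@le_trans _ _ (c * (1 / r `^ (u + 1)) * (d * r ^+ k * pq_prod X b))).
  by rewrite le_eqVlt; apply/orP; left; apply/eqP; ring.
by rewrite ler_wpM2l ?hd// mulr_ge0 ?(ltW c0)// divr_ge0 ?powR_ge0.
Qed.

(** Near r = 0 the integrand is at least a multiple of r^(k-u-1) >= 1/r, so the inner integral is
    infinite for every [b]. *)
Lemma improper_of_large_u : k%:R <= u -> ~ posterior_proper X n y prior.
Proof.
move=> ku; rewrite /posterior_proper.
have [c c0 hc] := prior_likelihood_ge.
suff -> : (\int[lebesgue_measure_tuple R m]_b
     \int[mu]_(r in `]0%R, +oo[) (prior r b * likelihood X n y r b)%:E = +oo)%E.
  by rewrite ltxx.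
rewrite (eq_integral (cst +oo%E)); last first.
  move=> b _; apply/eqP; rewrite -leye_eq.
  have A0 : 0 < c * pq_prod X b by rewrite mulr_gt0 ?pq_prod_gt0.
  rewrite -(integral_inv01 A0); apply: ge0_le_integral_subset => r /=.
  - by rewrite !in_itv/= => /andP[->].
  - rewrite in_itv/= lee_fin => /andP[r0 _].
    by rewrite mulr_ge0 ?invr_ge0 ?ltW.
  - rewrite in_itv/= lee_fin => /andP[r0 r1].
    apply: le_trans (hc r b _); last by rewrite r0 ltW.
    rewrite ler_pM2l// -powR_mulrn ?(ltW r0)// -powR_inv1 ?(ltW r0)// -powRB.
      by apply: ger_powR; [rewrite r0 ltW|lra].
    by apply/implyP => _; rewrite gt_eqF.
  - rewrite in_itv/= andbT lee_fin; exact: prior_likelihood_ge0.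
rewrite integral_cst// gt0_mulye//.
(* The whole space has positive measure because it contains a unit cube. *)
apply: (@lt_le_trans _ _ (lebesgue_measure_tuple R m (cube (fun=> 0)))).
  by rewrite lebesgue_cube.
by apply: le_measure; rewrite ?inE//; exact: measurable_cube.
Qed.

Lemma improper_of_rank_deficient : \rank X <> m -> ~ posterior_proper X n y prior.
Proof.
move=> rX; have [v [l0 [vl0 Xv]]] := kernel_vector rX.
have [d d0 hd] := pq_prod_ge_cubes Xv.
have [c c0 hc] := prior_likelihood_ge.
pose B : set (m.-tuple (measurableTypeR R)) :=
  \bigcup_N cube (fun l => (2 * N)%:R * v l).
have mB : measurable B by apply: bigcup_measurable => N _; exact: measurable_cube.
(* Restrict r to [1/2, 1], where r^k / r^(u+1) >= r^k >= 2^(-k); the last factor 1/2 is the length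
   of this interval. *)
pose e := c * d * 2^-1 ^+ k * 2^-1.
have e0 : 0 < e by rewrite !mulr_gt0// exprn_gt0.
rewrite /posterior_proper; apply/negP; rewrite -leNgt.
apply: (@le_trans _ _ (\int[lebesgue_measure_tuple R m]_(b in B) cst e%:E b)%E).
  by rewrite integral_cst//= /B (lebesgue_cubes vl0) gt0_muley ?lte_fin.
apply: ge0_le_integral_subset => // b.
- by rewrite lee_fin ltW.
- move=> [N _ /hd hb].
  pose a := c * d * 2^-1 ^+ k.
  have a0 : 0 <= a by rewrite !mulr_ge0 ?exprn_ge0 ?ltW.
  apply: (@le_trans _ _ (\int[mu]_(r in `[(2^-1)%R, 1%R]) cst a%:E r)%E).
    rewrite integral_cst//= lebesgue_measure_itv/= lte_fin ifT; last by lra.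
    by rewrite -EFinD -EFinM lee_fin /e -/a; lra.
  apply: ge0_le_integral_subset => r /=.
  + by rewrite !in_itv/= andbT => /andP[h1 _]; lra.
  + by rewrite lee_fin.
  + rewrite in_itv/= lee_fin => /andP[h1 h2].
    have r0 : 0 < r by lra.
    apply: le_trans (hc r b _); last by rewrite r0.
    rewrite /a -mulrA -[leRHS]mulrA ler_pM2l//.
    apply: ler_pM => //; first exact: ltW.
    apply: (@le_trans _ _ (r ^+ k)); first by rewrite lerXn2r ?nnegrE ?(ltW r0).
    rewrite ler_peMr ?exprn_ge0 ?(ltW r0)// invf_ge1 ?powR_gt0//.
    by apply: powR_le1; [rewrite r0|rewrite addr_ge0 ?(ltW u0)].
  + rewrite in_itv/= andbT lee_fin; exact: prior_likelihood_ge0.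
- move=> _; apply: integral_ge0 => r /=; rewrite in_itv/= andbT lee_fin.
  exact: prior_likelihood_ge0.
Qed.

Lemma posterior_properP :
  posterior_proper X n y prior <-> u < k%:R /\ \rank X = m.
Proof.
split; last by move=> [uk rX]; exact: proper_of_full_rank.
move=> P; split.
  by rewrite ltNge; apply/negP => ku; exact: improper_of_large_u P.
by apply: contrapT => rX; exact: improper_of_rank_deficient P.
Qed.

End posterior.

Unset Implicit Arguments.
Local Close Scope classical_set_scope.

(* For integral u the two conjuncts say the same thing; for u in (k - 1, k) not
   an integer, the posterior is proper (when X has rank m) although
   k >= u + 1 fails. *)
Theorem theorem3p3 (R : realType) (k m : nat)
    (hm : (1 <= m)%N) (hmk : (m <= k)%N)
    (n y : 'I_k -> nat) (X : 'M[R]_(k, m))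
    (hn : forall j, (1 <= n j)%N)
    (interior : forall j, (1 <= y j <= n j - 1)%N)
    (u : R) (hu : 0 < u)
    (prior : R -> m.-tuple R -> R)
    (hprior : proportional prior (fun r _ => 1 / r `^ (u + 1))) :
  (u \is a Num.int ->
    (posterior_proper X n y prior <-> u + 1 <= k%:R /\ \rank X = m)) /\
  (posterior_proper X n y prior <-> u < k%:R /\ \rank X = m).
Proof.
have main := posterior_properP X interior hu hprior.
split=> // /intrP[z uz].
have -> : (u + 1 <= k%:R) = (u < k%:R) by rewrite uz -intrD1 [k%:R]pmulrn ler_int ltr_int lezD1.
exact: main.
Qed.
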